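(* Let $n$ be a positive integer and let $A=[a_{i,j}]_{1\le i,j\le n}$ be a symmetric matrix over a commutative ring, with $a_{i,j}=0$ whenever $i+j\in\{2q:\ q=2,3,\ldots\}$. (i) If $n$ is even, then $$\mathrm{per}(A)=\left(\mathrm{per}[a_{2i,2j-1}]_{1\le i,j\le n/2}\right)^2$$ and $$(-1)^{n/2}\det(A)=\left(\det[a_{2i,2j-1}]_{1\le i,j\le n/2}\right)^2.$$ (ii) If $n>1$ and $n$ is odd, then $$\mathrm{per}(A)=a_{1,1}\left(\mathrm{per}[a_{2i,2j+1}]_{1\le i,j\le (n-1)/2}\right)^2$$ and $$(-1)^{(n-1)/2}\det(A)=a_{1,1}\left(\det[a_{2i,2j+1}]_{1\le i,j\le (n-1)/2}\right)^2.$$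
   Context: For an $n\times n$ matrix $A=[a_{i,j}]_{1\le i,j\le n}$ over a commutative ring, $\det(A)=\sum_{\sigma\in S_n}\mathrm{sign}(\sigma)\prod_{i=1}^n a_{i,\sigma(i)}$ is the determinant and $\mathrm{per}(A)=\sum_{\sigma\in S_n}\prod_{i=1}^n a_{i,\sigma(i)}$ is the permanent, where $S_n$ is the symmetric group on $\{1,\ldots,n\}$. *)

(* Defs.v *)
From mathcomp Require Import all_boot all_order all_fingroup all_algebra.

Set Implicit Arguments.
Unset Strict Implicit.
Unset Printing Implicit Defensive.

Import GRing.Theory.
Local Open Scope ring_scope.

Definition permanent (R : pzSemiRingType) (n : nat) (A : 'M[R]_n) : R :=
  \sum_(s : 'S_n) \prod_(i < n) A i (s i).

(* Main.v *)
Require Import Defs.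
From mathcomp Require Import all_boot all_order all_fingroup all_algebra.
From mathcomp Require Import zify.

(* If e^2 = 1, then [sgperm e A], the sum over s of e^(sign s) times the product
   of the entries A i (s i), is the permanent for e = 1 and the determinant for
   e = -1, so both cases are treated at once.  List the even indices first, then
   the odd ones (those greater than 1 followed by 1 itself when n is odd).
   Exchanging the i-th even index with the i-th odd one on the rows only costs
   the sign e^m, m being the number of even indices, and makes the matrix block
   triangular with diagonal blocks B^T and B (B^T, B and a 1 1 when n is odd). *)

Set Implicit Arguments.
Unset Strict Implicit.
Unset Printing Implicit Defensive.

Import GRing.Theory.
Local Open Scope ring_scope.

(** This allows index reorderings to be given by arithmetic formulas, with side conditions suited to
    [lia]. *)
Lemma ex_perm_nat (n : nat) (F : nat -> nat) :
    (forall i, (i < n)%N -> (F i < n)%N) ->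
    (forall i j, (i < n)%N -> (j < n)%N -> F i = F j -> i = j) ->
  exists p : 'S_n, forall i, p i = F i :> nat.
Proof.
move=> Flt Finj.
have h_inj : injective (fun i : 'I_n => Ordinal (Flt i (ltn_ord i))).
  by move=> i j /(congr1 val) /= /Finj ij; apply/val_inj/ij.
by exists (perm h_inj) => i; rewrite permE.
Qed.

(** Take the product of the m transpositions of [f i] and [g i]. They are disjoint because the
    images of [f] and [g] are, so none disturbs another. *)
Lemma ex_perm_swap (T : finType) (m : nat) (f g : 'I_m -> T) :
    injective f -> injective g -> (forall i j, f i != g j) ->
  exists s : {perm T},
    [/\ odd_perm s = odd m, forall i, s (f i) = g i, forall i, s (g i) = f i
      & forall x, (forall i, f i != x) -> (forall i, g i != x) -> s x = x].
Proof.
elim: m f g => [|m IHm] f g f_inj g_inj fg.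
  by exists 1%g; split=> [|[]|[]|x _ _] //; rewrite ?odd_perm1 ?perm1.
have [||i j|s [s_odd sf sg sx]] := IHm (f \o lift ord0) (g \o lift ord0).
- exact: inj_comp f_inj lift_inj.
- exact: inj_comp g_inj lift_inj.
- exact: fg.
exists (tperm (f ord0) (g ord0) * s)%g.
have f0 i : f (lift ord0 i) != f ord0 by rewrite (inj_eq f_inj) eq_sym neq_lift.
have g0 i : g (lift ord0 i) != g ord0 by rewrite (inj_eq g_inj) eq_sym neq_lift.
split=> [|i|i|x xf xg].
- by rewrite odd_permM odd_tperm fg s_odd.
- rewrite permM; case: (unliftP ord0 i) => [k|] ->; last first.
    by rewrite tpermL sx // => k; rewrite /= fg.
  by rewrite tpermD ?sf // eq_sym // fg.
- rewrite permM; case: (unliftP ord0 i) => [k|] ->; last first.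
    by rewrite tpermR sx // => k; rewrite /= eq_sym fg.
  by rewrite tpermD ?sg // eq_sym // eq_sym fg.
- by rewrite permM tpermD // sx // => i; rewrite ?xf ?xg.
Qed.

Section SignedPermanent.
Variables (R : comPzRingType) (e : R).

Definition sgperm n (A : 'M[R]_n) : R :=
  \sum_(s : 'S_n) e ^+ s * \prod_(i < n) A i (s i).

Lemma sgperm_tr n (A : 'M[R]_n) : sgperm A^T = sgperm A.
Proof.
rewrite /sgperm (reindex_inj invg_inj) /=; apply: eq_bigr => s _.
rewrite odd_permV (reindex_perm s); congr (_ * _).
by apply: eq_bigr => i _; rewrite mxE permK.
Qed.

Lemma sgperm0 (A : 'M[R]_0) : sgperm A = 1.
Proof.
rewrite /sgperm (big_pred1 1%g) => [|s]; last by apply/esym/eqP/permP; case.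
by rewrite odd_perm1 big_ord0 mulr1.
Qed.

Hypothesis ee : e * e = 1.

(** As e^2 = 1, the weight of a permutation is multiplicative, like the sign. *)
Lemma expr_addb (a b : bool) : e ^+ (a (+) b) = e ^+ a * e ^+ b.
Proof. by case: a b => [] []; rewrite ?mulr1 ?mul1r ?ee. Qed.

Lemma expr_odd m : e ^+ odd m = e ^+ m.
Proof. by elim: m => //= m IHm; rewrite -addTb expr_addb IHm -exprS. Qed.

Lemma sgperm_mxsub n (p q : 'S_n) (A : 'M[R]_n) :
  sgperm (mxsub p q A) = e ^+ (p (+) q) * sgperm A.
Proof.
rewrite /sgperm mulr_sumr [RHS](reindex (fun s => p^-1 * s * q)%g) /=.
  apply: eq_bigr => s _; rewrite mulrA -expr_addb !odd_permM odd_permV.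
  congr (e ^+ nat_of_bool _ * _); first by do 3!case: odd_perm.
  rewrite [RHS](reindex_perm p).
  by apply: eq_bigr => i _; rewrite mxE !permM permK.
exists (fun s => p * s * q^-1)%g => s _; first by rewrite !mulgA mulgV mul1g mulgK.
by rewrite !mulgA mulVg mul1g mulgKV.
Qed.

Lemma expand_sgperm_row0 n (A : 'M[R]_n.+1) :
  sgperm A =
    \sum_j A ord0 j * (e ^+ odd j * sgperm (row' ord0 (col' j A))).
Proof.
pose h (u : 'I_n.+1 * 'S_n) := lift_perm ord0 u.1 u.2.
(* A permutation is encoded by the image of [ord0] and what it induces on the other points.
   Injectivity suffices, since (n+1) n! = (n+1)!. *)
have h_bij : bijective h.
  apply: inj_card_bij => [[j s] [k t] eq_h|]; last first.
    by rewrite card_prod card_ord !card_Sn factS.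
  have jk : j = k by move/permP/(_ ord0): eq_h; rewrite !lift_perm_id.
  rewrite jk in eq_h *; congr (_, _); apply/permP => i.
  by move/permP/(_ (lift ord0 i)): eq_h; rewrite !lift_perm_lift => /lift_inj.
rewrite /sgperm (reindex h) /=; last exact: onW_bij.
rewrite -(pair_bigA _ (fun j s => e ^+ lift_perm ord0 j s *
  \prod_(i < n.+1) A i (lift_perm ord0 j s i))) /=.
apply: eq_bigr => j _; rewrite !mulr_sumr; apply: eq_bigr => s _.
rewrite big_ord_recl lift_perm_id odd_lift_perm addFb expr_addb mulrCA -mulrA.
do 3!congr (_ * _).
by apply: eq_bigr => i _; rewrite lift_perm_lift !mxE.
Qed.

(** Induction on m, expanding along the first row: columns of the zero block contribute nothing, and
    each remaining minor is again block triangular with the same [Z]. *)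
Lemma sgperm_lblock m k (X : 'M[R]_m) (Y : 'M_(k, m)) (Z : 'M_k) :
  sgperm (block_mx X 0 Y Z) = sgperm X * sgperm Z.
Proof.
elim: m X Y => [|m IHm] X Y.
  rewrite sgperm0 mul1r; congr sgperm.
  by apply/matrixP => i j; rewrite -(block_mxEdr X 0 Y Z); congr fun_of_matrix;
    apply: val_inj.
(* The row expansion is restated at size [m.+1 + k], so that its sum splits along the two column
   blocks. *)
have -> (N : 'M[R]_(m.+1 + k)) : sgperm N = \sum_j N (lshift k ord0) j *
    (e ^+ odd j * sgperm (row' (lshift k ord0) (col' j N))).
  rewrite [LHS](@expand_sgperm_row0 (m + k)).
  by have -> : ord0 = lshift k (@ord0 m) :> 'I_(m + k).+1 by exact: val_inj.
rewrite big_split_ord /= [X in _ + X]big1 ?addr0 => [|j _].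
  rewrite (expand_sgperm_row0 X) mulr_suml; apply: eq_bigr => j _.
  rewrite block_mxEul -!mulrA; do 2!congr (_ * _).
  by rewrite col'_col_mx !col'Kl row'Ku row'_row_mx row'_const IHm.
by rewrite block_mxEur mxE mul0r.
Qed.

Lemma sgperm_ublock m k (X : 'M[R]_m) (Y : 'M_(m, k)) (Z : 'M_k) :
  sgperm (block_mx X Y 0 Z) = sgperm X * sgperm Z.
Proof. by rewrite -sgperm_tr tr_block_mx trmx0 sgperm_lblock !sgperm_tr. Qed.

Lemma sgperm11 (A : 'M[R]_1) : sgperm A = A ord0 ord0.
Proof.
by rewrite expand_sgperm_row0 big_ord1 sgperm0 !mulr1.
Qed.

Lemma sgperm_even (m : nat) (a : nat -> nat -> R) :
    (forall i j, (0 < i <= m + m)%N -> (0 < j <= m + m)%N -> a i j = a j i) ->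
    (forall i j, (0 < i <= m + m)%N -> (0 < j <= m + m)%N ->
       (4 <= i + j)%N -> ~~ odd (i + j) -> a i j = 0) ->
  e ^+ m * sgperm (\matrix_(i < m + m, j < m + m) a i.+1 j.+1) =
  sgperm (\matrix_(i < m, j < m) a (2 * i.+1)%N (2 * j.+1 - 1)%N) ^+ 2.
Proof.
move=> a_sym a0; set A := (X in _ * sgperm X).
set B := (X in sgperm X ^+ 2).
(* Positions count from 0 and the arguments of [a] from 1, so the odd value 2i+1 stands for the even
   index 2i+2. *)
have [||p pE] := @ex_perm_nat (m + m)
  (fun i => if i < m then 2 * i + 1 else 2 * (i - m))%N.
- by move=> i; repeat case: ifP; lia.
- by move=> i j; repeat case: ifP; lia.
have [||i j|s [s_odd sl sr _]] :=
    ex_perm_swap (f := @lshift m m) (g := @rshift m m).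
- exact: lshift_inj.
- exact: rshift_inj.
- by rewrite eq_lrshift.
(* The parity of [p] occurs for both rows and columns and cancels; only that of [s] remains. *)
have <- : sgperm (mxsub (s * p)%g p A) = e ^+ m * sgperm A.
  by rewrite sgperm_mxsub odd_permM -addbA addbb addbF s_odd expr_odd.
have pl (i : 'I_m) : p (lshift m i) = (2 * i + 1)%N :> nat.
  by rewrite pE /= ltn_ord.
have pr (i : 'I_m) : p (rshift m i) = (2 * i)%N :> nat.
  by rewrite pE /= ltnNge leq_addr addKn.
(* The odd-odd block, where a 1 1 may survive, lies above the diagonal. The even-even block lies
   below and vanishes, its index sums being at least 4. *)
rewrite expr2 -{1}[sgperm B]sgperm_tr -(sgperm_ublock _ (ursubmx (mxsub (s * p)%g p A))).
congr sgperm; rewrite -[LHS]submxK.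
congr block_mx; apply/matrixP => i j; rewrite !mxE ?permM ?sl ?sr ?pl ?pr.
- rewrite a_sym; first (congr a; lia); have := ltn_ord i; have := ltn_ord j; lia.
- by have := ltn_ord i; have := ltn_ord j; move=> *; rewrite a0 //; lia.
- by congr a; lia.
Qed.

Lemma sgperm_odd (m : nat) (a : nat -> nat -> R) (n := (m + (m + 1))%N) :
    (forall i j, (0 < i <= n)%N -> (0 < j <= n)%N -> a i j = a j i) ->
    (forall i j, (0 < i <= n)%N -> (0 < j <= n)%N ->
       (4 <= i + j)%N -> ~~ odd (i + j) -> a i j = 0) ->
  e ^+ m * sgperm (\matrix_(i < n, j < n) a i.+1 j.+1) =
  a 1%N 1%N *
    sgperm (\matrix_(i < m, j < m) a (2 * i.+1)%N (2 * j.+1 + 1)%N) ^+ 2.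
Proof.
rewrite {}/n => a_sym a0; set A := (X in _ * sgperm X = _).
set B := (X in sgperm X ^+ 2).
(* The index 1 (value 0) comes last and is fixed by [s], which isolates a 1 1 as a diagonal
   block. *)
have [||p pE] := @ex_perm_nat (m + (m + 1)) (fun i => if i < m then 2 * i + 1
    else if i < m + m then 2 * (i - m) + 2 else 0)%N.
- by move=> i; repeat case: ifP; lia.
- by move=> i j; repeat case: ifP; lia.
have [||i j|s [s_odd sl sr sx]] :=
    ex_perm_swap (f := @lshift m (m + 1)) (g := fun i => rshift m (@lshift m 1 i)).
- exact: lshift_inj.
- by move=> i j /rshift_inj/lshift_inj.
- by rewrite eq_lrshift.
have s1 i : s (rshift m (rshift m i)) = rshift m (rshift m i).
  by rewrite sx // => j; rewrite ?eq_lrshift // (inj_eq (@rshift_inj _ _)) eq_lrshift.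
have <- : sgperm (mxsub (s * p)%g p A) = e ^+ m * sgperm A.
  by rewrite sgperm_mxsub odd_permM -addbA addbb addbF s_odd expr_odd.
have pl (i : 'I_m) : p (lshift (m + 1) i) = (2 * i + 1)%N :> nat.
  by rewrite pE /= ltn_ord.
have pr (i : 'I_m) : p (rshift m (lshift 1 i)) = (2 * i + 2)%N :> nat.
  by rewrite pE /=; have := ltn_ord i; case: ifP; [lia | case: ifP; lia].
have p1 (i : 'I_1) : p (rshift m (rshift m i)) = 0%N :> nat.
  by rewrite pE /=; case: ifP; [lia | case: ifP; lia].
set M := mxsub _ _ _.
(* Both zero blocks pair an odd index greater than 1 with an odd index, so their index sums are even
   and at least 4. Entries pairing 1 with an even index fall in the unconstrained blocks. *)
transitivity (sgperm (block_mx B^T 0 (dlsubmx M)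
    (block_mx B (ursubmx (drsubmx M)) 0 (a 1 1)%:M))); last first.
  rewrite sgperm_lblock sgperm_ublock sgperm_tr sgperm11 mxE mulr1n.
  by rewrite mulrA mulrC expr2.
congr sgperm; rewrite -[LHS]submxK -[drsubmx M in LHS]submxK.
congr block_mx; last congr block_mx; apply/matrixP => i j.
- rewrite !mxE ?permM ?sl ?pl ?pr; have := ltn_ord i; have := ltn_ord j => *.
  rewrite a_sym; first (congr a; lia); lia.
- rewrite !mxE permM sl; case: (split_ordP j) => k ->; have := ltn_ord i.
    by have := ltn_ord k; rewrite !pr => *; rewrite a0 //; lia.
  by rewrite pr p1 => *; rewrite a0 //; lia.
- by rewrite !mxE ?permM ?sr ?pl ?pr; congr a; lia.
- rewrite !mxE ?permM ?s1 ?pr ?p1; have := ltn_ord i; have := ltn_ord j => *.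
  by rewrite a0 //; lia.
- by rewrite !mxE ?permM ?s1 ?p1 !ord1.
Qed.

End SignedPermanent.

Lemma permanentE (R : comPzRingType) n (A : 'M[R]_n) : permanent A = sgperm 1 A.
Proof. by apply: eq_bigr => s _; rewrite expr1n mul1r. Qed.

(* [a i j] is the entry of [A] with the usual indices starting at 1; only its
   values for 1 <= i, j <= n are used. *)
Theorem corollary1p2 (R : comPzRingType) (n : nat) (n_gt0 : (0 < n)%N)
    (a : nat -> nat -> R) (A : 'M[R]_n)
    (A_def : A = \matrix_(i < n, j < n) a i.+1 j.+1)
    (A_sym : A^T = A)
    (a_eq0 : forall i j : nat, (1 <= i <= n)%N -> (1 <= j <= n)%N ->
       (exists2 q : nat, (2 <= q)%N & (i + j = 2 * q)%N) -> a i j = 0) :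
  (~~ odd n ->
     permanent A =
       permanent (\matrix_(i < n./2, j < n./2)
         a (2 * i.+1)%N (2 * j.+1 - 1)%N) ^+ 2
     /\
     (-1) ^+ n./2 * \det A =
       \det (\matrix_(i < n./2, j < n./2)
         a (2 * i.+1)%N (2 * j.+1 - 1)%N) ^+ 2)
  /\
  ((1 < n)%N -> odd n ->
     permanent A =
       a 1%N 1%N * permanent (\matrix_(i < (n - 1)./2, j < (n - 1)./2)
         a (2 * i.+1)%N (2 * j.+1 + 1)%N) ^+ 2
     /\
     (-1) ^+ (n - 1)./2 * \det A =
       a 1%N 1%N * \det (\matrix_(i < (n - 1)./2, j < (n - 1)./2)
         a (2 * i.+1)%N (2 * j.+1 + 1)%N) ^+ 2).
Proof.
have a_sym i j : (0 < i <= n)%N -> (0 < j <= n)%N -> a i j = a j i.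
  case: i j => [|i] [|j] //= i_lt j_lt.
  by move/matrixP/(_ (Ordinal j_lt) (Ordinal i_lt)): A_sym; rewrite A_def !mxE.
have a0 i j : (0 < i <= n)%N -> (0 < j <= n)%N -> (4 <= i + j)%N ->
    ~~ odd (i + j) -> a i j = 0.
  move=> i_n j_n ij_ge ij_even; apply: a_eq0 => //.
  by exists (i + j)./2; lia.
rewrite {}A_def in A_sym *; split=> [n_even | _ n_odd].
  have nE : n = (n./2 + n./2)%N by lia.
  (* Generalizing the half allows n to be replaced by m + m in the matrix sizes. *)
  move: (n./2) nE => m nE; subst n; rewrite !permanentE; split.
    by rewrite -(sgperm_even (mulr1 1) a_sym a0) expr1n mul1r.
  (* [\det] unfolds to [sgperm (-1)], and here e^m is the sign in the claim. *)
  exact: (sgperm_even (etrans (mulrNN 1 1) (mulr1 1)) a_sym a0).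
have nE : n = ((n - 1)./2 + ((n - 1)./2 + 1))%N by lia.
move: ((n - 1)./2) nE => m nE; subst n; rewrite !permanentE; split.
  by rewrite -(sgperm_odd (mulr1 1) a_sym a0) expr1n mul1r.
exact: (sgperm_odd (etrans (mulrNN 1 1) (mulr1 1)) a_sym a0).
Qed.
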